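(* There is a reflector functor $Id$ from the category of marked quantales (with marked quantale maps) to the category of quantales (with quantale morphisms), i.e. a left adjoint to the inclusion functor $E$ given by $E(Q)=(Q,\mathcal P(Q))$, $E(f)=f$. On objects it is $(S,\mathcal A)\mapsto Id_{\mathcal A}(S)$. A marked quantale map $f\colon(S,\mathcal A)\to(T,\mathcal B)$ is sent to the quantale morphism $Id(f)\colon Id_{\mathcal A}(S)\to Id_{\mathcal B}(T)$ given by $$Id(f)(D)=\mathsf j_{\mathcal B}(f(D){\downarrow})\qquad\text{for every } D\in Id_{\mathcal A}(S),$$ which makes the square $Id(f)\circ t_S=t_T\circ f$ commute, where $t_S\colon S\to Id_{\mathcal A}(S)$, $t_S(s)=s{\downarrow}$, and $t_T\colon T\to Id_{\mathcal B}(T)$, $t_T(x)=x{\downarrow}$, are the reflection morphisms.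
   Context: A posemigroup is a semigroup with a partial order $\leqslant$ compatible with multiplication in both arguments; posemigroup morphisms are the monotone multiplicative maps. $S^1$ denotes $S$ if $S$ has an identity element, and otherwise $S$ with an identity $1$ adjoined. $\mathcal P(X)$ is the power set of $X$. A quantale is a posemigroup that is a complete lattice in which multiplication distributes over arbitrary joins in both arguments; quantale morphisms preserve multiplication and arbitrary joins. A marked posemigroup is a pair $(S,\mathcal A)$ with $S$ a posemigroup and $\mathcal A\subseteq\mathcal P(S)$ such that (A1) $\{a\}\in\mathcal A$ for all $a\in S$; (A2) if $G\in\mathcal A$ and $a,b\in S^1$, then $\{axb\mid x\in G\}\in\mathcal A$. Members of $\mathcal A$ are called admissible subsets. A marked posemigroup $(S,\mathcal A)$ is a marked quantale if every admissible subset $M$ has a join in $S$ and $a(\bigvee M)b=\bigvee (aMb)$ for all $a,b\in S^1$. A marked quantale map $f\colon(S,\mathcal A)\to(S',\mathcal A')$ is a posemigroup morphism $f\colon S\to S'$ such that $f(M)\in\mathcal A'$ and $f(\bigvee M)=\bigvee f(M)$ for every $M\in\mathcal A$. For $X\subseteq S$, $X{\downarrow}=\{p\in S\mid p\leqslant x\text{ for some }x\in X\}$, and $s{\downarrow}=\{s\}{\downarrow}$. A lower subset is an $X\subseteq S$ with $X{\downarrow}=X$ ($\emptyset$ included). An $\mathcal A$-ideal of $S$ is a lower subset $D$ of $S$ such that $\bigvee M\in D$ for every $M\in\mathcal A$ with $M\subseteq D$. $Id_{\mathcal A}(S)$ is the set of all $\mathcal A$-ideals of $S$, ordered by inclusion.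 For a lower subset $C$ of $S$, $\mathsf j_{\mathcal A}(C)=\bigcap\{D\in Id_{\mathcal A}(S)\mid C\subseteq D\}$. $Id_{\mathcal A}(S)$ is a quantale with multiplication $V\cdot W=\mathsf j_{\mathcal A}(\{vw\mid v\in V,w\in W\}{\downarrow})$ and joins $\bigvee_iD_i=\mathsf j_{\mathcal A}(\bigcup_iD_i)$. *)

(* Defs.v *)
From HB Require Import structures.
From mathcomp Require Import all_boot all_order.
From mathcomp Require Import boolp classical_sets.

Set Implicit Arguments.
Unset Strict Implicit.
Unset Printing Implicit Defensive.

Import Order.TTheory.

Local Open Scope classical_set_scope.
Local Open Scope order_scope.
Local Open Scope group_scope.

Record category := Category {
  obj :> Type;
  hom : obj -> obj -> Type;
  idm : forall a, hom a a;
  compm : forall a b c, hom b c -> hom a b -> hom a c;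
  compm_idl : forall a b (f : hom a b), compm (idm b) f = f;
  compm_idr : forall a b (f : hom a b), compm f (idm a) = f;
  compmA : forall a b c d (h : hom c d) (g : hom b c) (f : hom a b),
    compm h (compm g f) = compm (compm h g) f }.

Arguments idm {_} a.

Notation "g \oc f" := (compm g f) (at level 50, left associativity).

(* The object map is a parameter of the type of functors, so that a functor   *)
(* with a prescribed action on objects can be stated without transport.       *)
Record functor_on (C D : category) (F0 : C -> D) := Functor {
  fmap : forall a b : C, hom a b -> hom (F0 a) (F0 b);
  fmap1 : forall a : C, fmap (idm a) = idm (F0 a);
  fmapM : forall (a b c : C) (g : hom b c) (f : hom a b),
    fmap (g \oc f) = fmap g \oc fmap f }.

Record adjunction (C D : category) (F0 : C -> D) (G0 : D -> C)
    (F : functor_on F0) (G : functor_on G0) := Adjunction {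
  transpose : forall (c : C) (d : D), hom (F0 c) d -> hom c (G0 d);
  transpose_bij : forall c d, bijective (@transpose c d);
  transpose_natl : forall (c c' : C) (d : D) (f : hom c' c) (h : hom (F0 c) d),
    transpose (h \oc fmap F f) = transpose h \oc f;
  transpose_natr : forall (c : C) (d d' : D) (h : hom (F0 c) d) (g : hom d d'),
    transpose (g \oc h) = fmap G g \oc transpose h }.

Definition unit_of (C D : category) (F0 : C -> D) (G0 : D -> C)
    (F : functor_on F0) (G : functor_on G0) (adj : adjunction F G) (c : C) :
  hom c (G0 (F0 c)) := transpose adj (idm (F0 c)).

Definition is_reflection (C D : category) (G0 : D -> C) (G : functor_on G0)
    (c : C) (r : D) (t : hom c (G0 r)) : Prop :=
  forall (d : D) (g : hom c (G0 d)), exists! h : hom r d, fmap G h \oc t = g.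

(* A fixed display makes posemigroups a single type, with no parameter, so    *)
(* that they can be the objects of a category. The choice structure required  *)
(* by semigroupType and porderType is no restriction: boolp gives one to      *)
(* every type.                                                                *)
Fact posemigroup_display : Order.disp_t. Proof. exact. Qed.

HB.mixin Record isPosemigroup S of Semigroup S
    & Order.POrder posemigroup_display S := {
  lemg2l : forall a x y : S, x <= y -> a * x <= a * y;
  lemg2r : forall a x y : S, x <= y -> x * a <= y * a }.

#[short(type="posemigroupType")]
HB.structure Definition Posemigroup :=
  { S of isPosemigroup S & Semigroup S & Order.POrder posemigroup_display S }.

(* [supremums A m] and [infimums A m] say that m is the join, resp. the meet, *)
(* of A, so "A has a join" is [supremums A !=set0].                           *)
HB.mixin Record isQuantale Q of Posemigroup Q := {
  supremums_ex : forall A : set Q, supremums A !=set0;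
  infimums_ex : forall A : set Q, infimums A !=set0;
  mulg_supr : forall (a : Q) (A : set Q) (m : Q),
    supremums A m -> supremums [set a * x | x in A] (a * m);
  mulg_supl : forall (a : Q) (A : set Q) (m : Q),
    supremums A m -> supremums [set x * a | x in A] (m * a) }.

#[short(type="quantaleType")]
HB.structure Definition Quantale := { Q of isQuantale Q & Posemigroup Q }.

Definition posemigroup_morphism (S T : posemigroupType) (f : S -> T) : Prop :=
  {homo f : x y / x <= y} /\ {morph f : x y / x * y}.

Record quantaleHom (Q R : quantaleType) := QuantaleHom {
  quantale_fun :> Q -> R;
  quantale_funM : {morph quantale_fun : x y / x * y};
  quantale_fun_sup : forall (A : set Q) (m : Q),
    supremums A m -> supremums (quantale_fun @` A) (quantale_fun m) }.

Section Marked.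
Variable S : posemigroupType.

Definition is_identity (e : S) : Prop := left_id e mul /\ right_id e mul.

(* S^1 inside [option S]: every [Some a] belongs to it, and [None], which     *)
(* stands for the adjoined 1, does only when S has no identity element.       *)
Definition unitization : set (option S) :=
  [set a | a = None -> ~ exists e, is_identity e].

Definition lmul1 (a : option S) (x : S) : S :=
  if a is Some a' then a' * x else x.
Definition rmul1 (x : S) (b : option S) : S :=
  if b is Some b' then x * b' else x.

Definition sandwich (a : option S) (x : S) (b : option S) : S :=
  rmul1 (lmul1 a x) b.

Definition marked_posemigroup (A : set (set S)) : Prop :=
  (forall a : S, A [set a]) /\
  (forall (G : set S) (a b : option S), A G -> unitization a -> unitization b ->
     A [set sandwich a x b | x in G]).

Definition marked_quantale (A : set (set S)) : Prop :=
  [/\ marked_posemigroup A,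
      forall M : set S, A M -> supremums M !=set0 &
      forall (M : set S) (m : S) (a b : option S),
        A M -> supremums M m -> unitization a -> unitization b ->
        supremums [set sandwich a x b | x in M] (sandwich a m b)].

(* [classical_sets.down X] is the set of elements below some element of X.    *)
Definition lower (X : set S) : Prop := down X = X.

Definition is_ideal (A : set (set S)) (D : set S) : Prop :=
  lower D /\
  forall (M : set S) (m : S), A M -> M `<=` D -> supremums M m -> D m.

Definition jhull (A : set (set S)) (C : set S) : set S :=
  \bigcap_(D in [set D | is_ideal A D /\ C `<=` D]) D.

End Marked.

Record markedQuantale := MarkedQuantale {
  mq_sort :> posemigroupType;
  admissible : set (set mq_sort);
  mqP : marked_quantale admissible }.

Record markedHom (S T : markedQuantale) := MarkedHom {
  marked_fun :> S -> T;
  marked_fun_morph : posemigroup_morphism marked_fun;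
  marked_fun_adm : forall M, admissible M -> admissible (marked_fun @` M);
  marked_fun_sup : forall M m, admissible M ->
    supremums M m -> supremums (marked_fun @` M) (marked_fun m) }.

Section IdealLemmas.
Variable S : markedQuantale.
Local Notation A := (@admissible S).
Local Notation j := (jhull A).
Implicit Types (C D V W : set S).

Lemma lowerP D : (forall x y, x <= y -> D y -> D x) -> lower D.
Proof.
move=> h; apply/seteqP; split=> x.
  by case=> y [Dy le_xy]; exact: h le_xy Dy.
by move=> Dx; exists x; split.
Qed.

Lemma ideal_le D x y : is_ideal A D -> x <= y -> D y -> D x.
Proof.
move=> [<- _] le_xy [z [Dz le_yz]].
by exists z; split=> //; exact: le_trans le_yz.
Qed.

Lemma bigcap_is_ideal (F : set (set S)) :
  (forall D, F D -> is_ideal A D) -> is_ideal A (\bigcap_(D in F) D).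
Proof.
move=> FI; split; first by apply: lowerP => x y le_xy Dy D FD;
  exact: ideal_le (FI _ FD) le_xy (Dy _ FD).
move=> M m AM sMD supm D FD; have [_ h] := FI _ FD; apply: h supm => //.
by move=> x /sMD; apply.
Qed.

Lemma jhull_is_ideal C : is_ideal A (j C).
Proof. by apply: bigcap_is_ideal => D []. Qed.

Lemma sub_jhull C : C `<=` j C.
Proof. by move=> x Cx D [_]; apply. Qed.

Lemma jhull_min C D : is_ideal A D -> C `<=` D -> j C `<=` D.
Proof. by move=> ID sCD x; apply. Qed.

Lemma sub_down C : C `<=` down C.
Proof. by move=> x Cx; exists x; split. Qed.

Lemma down_min C D : is_ideal A D -> C `<=` D -> down C `<=` D.
Proof.
by move=> ID sCD x [y [Cy le_xy]]; exact: ideal_le ID le_xy (sCD _ Cy).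
Qed.

Lemma down1_is_ideal (s : S) : is_ideal A (down [set s]).
Proof.
split; first by apply: lowerP => x y le_xy [_ [-> le_ys]];
  exists s; split=> //; exact: le_trans le_ys.
move=> M m _ sMD [_ supm]; exists s; split=> //.
by apply: supm => x /sMD[_ [->]].
Qed.

Lemma unitization_mull (a : S) :
  exists b, unitization b /\ forall x, sandwich (Some a) x b = a * x.
Proof.
have [[e [e1 e2]]|ne] := pselect (exists e : S, is_identity e).
  by exists (Some e); split=> // x; rewrite /sandwich /= e2.
by exists None; split=> // _; exact: ne.
Qed.

Lemma unitization_mulr (a : S) :
  exists b, unitization b /\ forall x, sandwich b x (Some a) = x * a.
Proof.
have [[e [e1 e2]]|ne] := pselect (exists e : S, is_identity e).
  by exists (Some e); split=> // x; rewrite /sandwich /= e1.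
by exists None; split=> // _; exact: ne.
Qed.

Lemma sandwich_le (a b : option S) (x y : S) :
  x <= y -> sandwich a x b <= sandwich a y b.
Proof.
move=> h; rewrite /sandwich; case: b => [b|] /=; [apply: lemg2r|];
  by case: a => [a|] //=; exact: lemg2l.
Qed.

Lemma residual_is_ideal D (a b : option S) :
  is_ideal A D -> unitization a -> unitization b ->
  is_ideal A [set x | D (sandwich a x b)].
Proof.
move=> ID ua ub; split.
  by apply: lowerP => x y /(sandwich_le a b); exact: ideal_le.
have [[_ A2] _ A3] := mqP S; have [_ Dsup] := ID.
move=> M m AM sMD supm /=; apply: (Dsup [set sandwich a x b | x in M]).
- exact: A2.
- by move=> _ [x /sMD ? <-].
- exact: A3.
Qed.

Lemma jhull_mull (a : S) C D :
  is_ideal A D -> (forall x, C x -> D (a * x)) -> forall x, j C x -> D (a * x).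
Proof.
move=> ID sCD; have [b [ub bE]] := unitization_mull a.
have ua : unitization (Some a) by [].
have /jhull_min h := residual_is_ideal ID ua ub.
by move=> x; rewrite -bE; apply: h => y /sCD; rewrite -bE.
Qed.

Lemma jhull_mulr (a : S) C D :
  is_ideal A D -> (forall x, C x -> D (x * a)) -> forall x, j C x -> D (x * a).
Proof.
move=> ID sCD; have [b [ub bE]] := unitization_mulr a.
have ua : unitization (Some a) by [].
have /jhull_min h := residual_is_ideal ID ub ua.
by move=> x; rewrite -bE; apply: h => y /sCD; rewrite -bE.
Qed.

End IdealLemmas.

Record ideal (S : markedQuantale) := Ideal {
  ideal_set :> set S;
  idealP : `[< is_ideal (@admissible S) ideal_set >] }.

HB.instance Definition _ (S : markedQuantale) := [isSub for @ideal_set S].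
HB.instance Definition _ (S : markedQuantale) := [Choice of ideal S by <:].
HB.instance Definition _ (S : markedQuantale) :=
  [SubChoice_isSubPOrder of ideal S by <: with posemigroup_display].

Section IdealQuantale.
Variable S : markedQuantale.
Local Notation A := (@admissible S).
Implicit Types (C : set S) (D V W U : ideal S).

Lemma ideal_is_ideal D : is_ideal A D.
Proof. exact/asboolP/idealP. Qed.

Lemma le_idealE V W : (V <= W) = (V `<=` W) :> Prop.
Proof. by rewrite -subsetEset. Qed.

Lemma eq_ideal V W : (V : set S) = W -> V = W.
Proof. exact: val_inj. Qed.

Definition jideal C : ideal S := Ideal (asboolT (jhull_is_ideal C)).

Definition principal (s : S) : ideal S := Ideal (asboolT (down1_is_ideal s)).

Definition ideal_mul V W : ideal S :=
  jideal (down [set v * w | v in V & w in W]).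

Definition ideal_sup (F : set (ideal S)) : ideal S :=
  jideal (\bigcup_(D in F) D).

Lemma ideal_mul_sub V W D :
  (forall v w, ideal_set V v -> ideal_set W w -> ideal_set D (v * w)) <->
  ideal_mul V W `<=` D.
Proof.
have ID := ideal_is_ideal D; split=> [h|h v w Vv Ww].
  by apply: jhull_min => //; apply: down_min => // _ [v Vv [w Ww <-]]; exact: h.
by apply: h; apply: sub_jhull; apply: sub_down; exists v => //; exists w.
Qed.

Lemma ideal_mul_in V W (v w : S) :
  ideal_set V v -> ideal_set W w -> ideal_set (ideal_mul V W) (v * w).
Proof. by move: v w; apply/ideal_mul_sub. Qed.

Lemma ideal_sup_sub (F : set (ideal S)) D :
  (forall V, F V -> V `<=` D) -> ideal_sup F `<=` D.
Proof.
by move=> h; apply: jhull_min; [exact: ideal_is_ideal | move=> x [V /h]; apply].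
Qed.

Lemma sub_ideal_sup (F : set (ideal S)) V : F V -> V `<=` ideal_sup F.
Proof. by move=> FV x Vx; apply: sub_jhull; exists V. Qed.

Lemma ideal_supremum (F : set (ideal S)) : supremums F (ideal_sup F).
Proof.
split=> [V FV|W ubW]; rewrite le_idealE; first exact: sub_ideal_sup.
by apply: ideal_sup_sub => V /ubW; rewrite le_idealE.
Qed.

Lemma ideal_mulA : associative ideal_mul.
Proof.
move=> V W U; apply: eq_ideal; apply/seteqP; split.
  apply/ideal_mul_sub => v y Vv; move: y; apply: jhull_mull.
    exact: ideal_is_ideal.
  move=> y [_ [[w Ww [u Uu <-]] le]].
  apply: (ideal_le (ideal_is_ideal _) (lemg2l v _ _ le)).
  by rewrite mulgA; apply: ideal_mul_in => //; exact: ideal_mul_in.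
apply/ideal_mul_sub => y u; move/[swap] => Uu; move: y; apply: jhull_mulr.
  exact: ideal_is_ideal.
move=> y [_ [[v Vv [w Ww <-]] le]].
apply: (ideal_le (ideal_is_ideal _) (lemg2r u _ _ le)).
by rewrite -mulgA; apply: ideal_mul_in => //; exact: ideal_mul_in.
Qed.

HB.instance Definition _ := isSemigroup.Build (ideal S) ideal_mulA.

Fact ideal_lemg2l (U V W : ideal S) : V <= W -> U * V <= U * W.
Proof.
rewrite !le_idealE => sVW; apply/ideal_mul_sub => u v Uu /sVW.
exact: ideal_mul_in.
Qed.

Fact ideal_lemg2r (U V W : ideal S) : V <= W -> V * U <= W * U.
Proof.
rewrite !le_idealE => sVW; apply/ideal_mul_sub => v u /sVW.
exact: ideal_mul_in.
Qed.

HB.instance Definition _ :=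
  isPosemigroup.Build (ideal S) ideal_lemg2l ideal_lemg2r.

Fact ideal_supremums_ex (F : set (ideal S)) : supremums F !=set0.
Proof. by exists (ideal_sup F); exact: ideal_supremum. Qed.

Fact ideal_infimums_ex (F : set (ideal S)) : infimums F !=set0.
Proof.
exists (ideal_sup (lbound F)); have [ubL lubL] := ideal_supremum (lbound F).
by split=> // V FV; apply: lubL => W; apply.
Qed.

Fact ideal_mulg_supr (V : ideal S) (F : set (ideal S)) (m : ideal S) :
  supremums F m -> supremums [set V * x | x in F] (V * m).
Proof.
move=> [ubm lubm]; split=> [_ [W /ubm Wm <-]|W ubW]; first exact: ideal_lemg2l.
have /subset_trans : V * m `<=` V * ideal_sup F.
  by rewrite -le_idealE; apply/ideal_lemg2l/lubm; case: (ideal_supremum F).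
rewrite le_idealE; apply; apply/ideal_mul_sub => v y Vv; move: y.
apply: jhull_mull => [|x [U FU Ux]]; first exact: ideal_is_ideal.
have : V * U <= W by apply: ubW; exists U.
by rewrite le_idealE; apply; exact: ideal_mul_in.
Qed.

Fact ideal_mulg_supl (V : ideal S) (F : set (ideal S)) (m : ideal S) :
  supremums F m -> supremums [set x * V | x in F] (m * V).
Proof.
move=> [ubm lubm]; split=> [_ [W /ubm Wm <-]|W ubW]; first exact: ideal_lemg2r.
have /subset_trans : m * V `<=` ideal_sup F * V.
  by rewrite -le_idealE; apply/ideal_lemg2r/lubm; case: (ideal_supremum F).
rewrite le_idealE; apply; apply/ideal_mul_sub => y v /[swap] Vv; move: y.
apply: jhull_mulr => [|x [U FU Ux]]; first exact: ideal_is_ideal.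
have : U * V <= W by apply: ubW; exists U.
by rewrite le_idealE; apply; exact: ideal_mul_in.
Qed.

HB.instance Definition _ := isQuantale.Build (ideal S)
  ideal_supremums_ex ideal_infimums_ex ideal_mulg_supr ideal_mulg_supl.

End IdealQuantale.

Lemma quantaleHom_eq (Q R : quantaleType) (f g : quantaleHom Q R) :
  f =1 g -> f = g.
Proof.
case: f g => [f p q] [g p' q'] /= /funext e; subst g.
by rewrite (Prop_irrelevance p p') (Prop_irrelevance q q').
Qed.

Lemma markedHom_eq (S T : markedQuantale) (f g : markedHom S T) :
  f =1 g -> f = g.
Proof.
case: f g => [f p q r] [g p' q' r'] /= /funext e; subst g.
rewrite (Prop_irrelevance p p') (Prop_irrelevance q q').
by rewrite (Prop_irrelevance r r').
Qed.

Definition quantale_id (Q : quantaleType) : quantaleHom Q Q.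
Proof. by refine (@QuantaleHom Q Q id _ _) => // A m; rewrite image_id. Defined.

Definition quantale_comp (Q R T : quantaleType)
    (g : quantaleHom R T) (f : quantaleHom Q R) : quantaleHom Q T.
Proof.
refine (@QuantaleHom Q T (g \o f) _ _) => [x y|A m h] /=.
  by rewrite !quantale_funM.
by rewrite -image_comp; do 2!apply: quantale_fun_sup.
Defined.

Definition marked_id (S : markedQuantale) : markedHom S S.
Proof.
by refine (@MarkedHom S S id _ _ _) => [|M|M m _]; rewrite ?image_id //; split.
Defined.

Definition marked_comp (S T U : markedQuantale)
    (g : markedHom T U) (f : markedHom S T) : markedHom S U.
Proof.
refine (@MarkedHom S U (g \o f) _ _ _) => [|M AM|M m AM h].
- have [gle gM] := marked_fun_morph g; have [fle fM] := marked_fun_morph f.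
  by split=> [x y /fle /gle|x y] //=; rewrite fM gM.
- by rewrite -image_comp; do 2!apply: marked_fun_adm.
- rewrite -image_comp.
  by apply: marked_fun_sup; [exact: marked_fun_adm | exact: marked_fun_sup].
Defined.

Definition quantaleCat : category.
Proof.
refine (@Category quantaleType quantaleHom quantale_id quantale_comp _ _ _);
  by move=> *; apply: quantaleHom_eq.
Defined.

Definition markedQuantaleCat : category.
Proof.
refine (@Category markedQuantale markedHom marked_id marked_comp _ _ _);
  by move=> *; apply: markedHom_eq.
Defined.

Lemma power_marked_quantale (Q : quantaleType) :
  marked_quantale [set: set Q].
Proof.
split=> [|M _|M m a b _ supm _ _]; [by split | exact: supremums_ex |].
have supl : supremums [set lmul1 a x | x in M] (lmul1 a m).
  by case: a => [a|] /=; [exact: mulg_supr | rewrite image_id].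
rewrite -(image_comp (lmul1 a) (fun y => rmul1 y b)).
by rewrite /sandwich; case: b => [b|] /=; [exact: mulg_supl | rewrite image_id].
Qed.

Definition E_obj (Q : quantaleCat) : markedQuantaleCat :=
  MarkedQuantale (power_marked_quantale Q).

Lemma quantale_fun_le (Q R : quantaleType) (f : quantaleHom Q R) :
  {homo f : x y / x <= y}.
Proof.
move=> x y le_xy.
have : supremums [set x; y] y.
  by split=> [z [->|->] //|z]; apply; right.
by move=> /(quantale_fun_sup f)[ub _]; apply: ub; exists x => //; left.
Qed.

Definition E_mor (Q R : quantaleCat) (f : quantaleHom Q R) :
  markedHom (E_obj Q) (E_obj R).
Proof.
refine (@MarkedHom (E_obj Q) (E_obj R) f _ _ _) => // [|M m _].
  by split; [exact: quantale_fun_le | exact: quantale_funM].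
exact: quantale_fun_sup.
Defined.

Definition E : functor_on E_obj.
Proof. by refine (@Functor _ _ E_obj E_mor _ _) => *; apply: markedHom_eq. Defined.

Definition Id_obj (S : markedQuantaleCat) : quantaleCat := ideal S.

(* Main.v *)
(* The principal ideals make [t_S : s |-> down [set s]] a marked quantale     *)
(* map, and every ideal is the join of the principal ideals of its elements;  *)
(* hence a quantale morphism out of the ideals is determined by its           *)
(* composition with [t_S]. Conversely, a marked quantale map g into a         *)
(* quantale Q extends to ideals by D |-> \/ g(D). The key point is that       *)
(* { s | g s <= q } is an ideal for every q in Q, so that an upper bound of   *)
(* g(C) is also one of g(j C). The functor [Id] sends f to the extension of   *)
(* [t_T \o f].                                                                *)
Require Import Defs.
From mathcomp Require Import all_boot all_order.
From mathcomp Require Import boolp classical_sets.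

Import Order.TTheory.

Local Open Scope classical_set_scope.
Local Open Scope order_scope.
Local Open Scope group_scope.

(** Everything reduces to the universal property of [reflection]. Uniqueness comes from
    [supremums_principal]: a join-preserving map is fixed by its values on principal ideals.
    Existence comes from [extend], which by [extend_leP] is left adjoint to [q |-> {s | g s <= q}];
    this takes values in ideals by [preim_le_is_ideal], whence joins and products are preserved.
    Functoriality and the adjunction then follow formally, and only the explicit formula for [Id(f)]
    needs a further argument, [Id_morE]. *)

Lemma supremums_uniq (Q : quantaleType) (A : set Q) (m n : Q) :
  supremums A m -> supremums A n -> m = n.
Proof.
move=> [ubm lubm] [ubn lubn].
by apply/eqP; rewrite eq_le lubm // lubn.
Qed.

Definition qsup (Q : quantaleType) (A : set Q) : Q :=
  sval (cid (supremums_ex A)).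

Lemma qsupP (Q : quantaleType) (A : set Q) : supremums A (qsup Q A).
Proof. exact: svalP (cid (supremums_ex A)). Qed.

Lemma qsup_leP (Q : quantaleType) (A : set Q) (q : Q) :
  (forall x, A x -> x <= q) <-> qsup Q A <= q.
Proof.
have [ubA lubA] := qsupP Q A; split=> [/lubA //|le_q x /ubA le_x].
exact: le_trans le_q.
Qed.

Section Reflection.
Variable S : markedQuantale.

Lemma mem_principal (s x : S) : ideal_set (principal s) x <-> x <= s.
Proof. by split=> [[_ [-> //]]|le_xs]; exists s. Qed.

Lemma principal_leP (s : S) (D : ideal S) :
  principal s <= D <-> ideal_set D s.
Proof.
rewrite le_idealE; split=> [|Ds]; first by apply; exact/mem_principal.
by apply: down_min; [exact: ideal_is_ideal | move=> _ ->].
Qed.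

Lemma supremums_principal (D : ideal S) :
  supremums [set principal s | s in ideal_set D] D.
Proof.
split=> [_ [s Ds <-]|W ubW]; first exact/principal_leP.
by rewrite le_idealE => s Ds; apply/principal_leP/ubW; exists s.
Qed.

Lemma principal_homo : {homo @principal S : x y / x <= y}.
Proof. by move=> x y le_xy; apply/principal_leP/mem_principal. Qed.

Lemma principalM : {morph @principal S : x y / x * y}.
Proof.
move=> x y; apply/eqP; rewrite eq_le; apply/andP; split.
  by apply/principal_leP; apply: ideal_mul_in; exact/mem_principal.
rewrite le_idealE; apply/ideal_mul_sub => v w /mem_principal vx /mem_principal wy.
apply/mem_principal.
exact: le_trans (lemg2r _ _ _ vx) (lemg2l _ _ _ wy).
Qed.

(** An ideal containing [M] contains [m]: this is the closure of ideals under admissible joins. *)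
Lemma principal_sup (M : set S) (m : S) : admissible M ->
  supremums M m -> supremums [set principal s | s in M] (principal m).
Proof.
move=> AM supm; split=> [_ [s Ms <-]|W ubW].
  by apply: principal_homo; apply: supm.1.
apply/principal_leP; have [_ Wsup] := ideal_is_ideal W.
by apply: Wsup AM _ supm => s Ms; apply/principal_leP/ubW; exists s.
Qed.

Definition reflection : markedHom S (E_obj (ideal S)) :=
  @MarkedHom S (E_obj (ideal S)) (@principal S)
    (conj principal_homo principalM) (fun _ _ => I) principal_sup.

Variables (Q : quantaleType) (g : markedHom S (E_obj Q)).

(** If [q] bounds [g(M)], it bounds [g m], since [g] makes [g m] the least upper bound of [g(M)]. *)
Lemma preim_le_is_ideal (q : Q) :
  is_ideal (@admissible S) [set s | (g s : Q) <= q].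
Proof.
have [g_le _] := marked_fun_morph g; split.
  by apply: lowerP => x y /g_le; exact: le_trans.
move=> M m AM sMq /(marked_fun_sup g AM)[_]; apply=> _ [s Ms <-]; exact: sMq.
Qed.

Definition extend (D : ideal S) : Q :=
  qsup Q [set (g s : Q) | s in ideal_set D].

Lemma extend_leP (D : ideal S) (q : Q) :
  ideal_set D `<=` [set s | (g s : Q) <= q] <-> extend D <= q.
Proof.
split=> [sDq|/qsup_leP h s Ds]; last by apply: h; exists s.
by apply/qsup_leP => _ [s Ds <-]; exact: sDq.
Qed.

Lemma extend_ge (D : ideal S) (s : S) : ideal_set D s -> (g s : Q) <= extend D.
Proof. by move=> Ds; have /extend_leP := lexx (extend D); apply. Qed.

Lemma extendM : {morph extend : V W / V * W}.
Proof.
move=> V W; have [_ gM] := marked_fun_morph g.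
apply/eqP; rewrite eq_le; apply/andP; split.
  (* With the bound packaged as an ideal, only the products [v * w] have to be tested, not the whole
     hull. *)
  pose D : ideal S :=
    Ideal (asboolT (preim_le_is_ideal (extend V * extend W))).
  apply/extend_leP; apply: (iffLR (ideal_mul_sub V W D)) => v w Vv Ww /=.
  rewrite gM; apply: le_trans (lemg2r _ _ _ (extend_ge V v Vv)) _.
  exact: lemg2l (extend_ge W w Ww).
(* Conversely, distributing over the two defining joins leaves [g v * g w], which is [g (v * w)]. *)
have [_] := mulg_supl (extend W) _ _
  (qsupP Q [set (g s : Q) | s in ideal_set V]).
apply=> _ [_ [v Vv <-] <-].
have [_] := mulg_supr (g v : Q) _ _
  (qsupP Q [set (g s : Q) | s in ideal_set W]).
apply=> _ [_ [w Ww <-] <-].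
by have := extend_ge (V * W) (v * w) (ideal_mul_in Vv Ww); rewrite gM.
Qed.

Lemma extend_sup (F : set (ideal S)) (m : ideal S) :
  supremums F m -> supremums (extend @` F) (extend m).
Proof.
move=> supm; have -> := supremums_uniq _ _ _ _ supm (ideal_supremum F).
split=> [_ [V FV <-]|q ubq].
  by apply/extend_leP => s Vs; apply: extend_ge; exact: sub_ideal_sup FV s Vs.
pose D : ideal S := Ideal (asboolT (preim_le_is_ideal q)).
apply/extend_leP; apply: (@ideal_sup_sub _ F D) => V FV.
by apply/extend_leP/ubq; exists V.
Qed.

Definition extension : quantaleHom (ideal S) Q :=
  QuantaleHom extendM extend_sup.

Lemma extension_principal (s : S) : extension (principal s) = g s.
Proof.
have [g_le _] := marked_fun_morph g.
apply/eqP; rewrite eq_le; apply/andP; split.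
  by apply/extend_leP => x /mem_principal /g_le.
exact/extend_ge/mem_principal.
Qed.

Lemma extension_reflection : marked_comp (E_mor extension) reflection = g.
Proof. by apply: markedHom_eq => s; exact: extension_principal. Qed.

Lemma extension_uniq (h : quantaleHom (ideal S) Q) :
  marked_comp (E_mor h) reflection = g -> h = extension.
Proof.
move=> hg; apply: quantaleHom_eq => D.
have := quantale_fun_sup h (supremums_principal D).
have -> : h @` [set principal s | s in ideal_set D] =
          [set (g s : Q) | s in ideal_set D].
  by rewrite image_comp -hg.
by move=> /supremums_uniq; apply; exact: qsupP.
Qed.

End Reflection.

Definition Id_mor (S T : markedQuantale) (f : markedHom S T) :
    quantaleHom (ideal S) (ideal T) :=
  extension S (ideal T) (marked_comp (reflection T) f).

(** The left side is the join of the ideals [principal (f s)]; an ideal lies above all of these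
    exactly when it contains [f(D)]. *)
Lemma Id_morE (S T : markedQuantale) (f : markedHom S T) (D : ideal S) :
  Id_mor S T f D = jideal (down [set f s | s in ideal_set D]).
Proof.
apply/eqP; rewrite eq_le; apply/andP; split.
  apply/extend_leP => s Ds; apply/principal_leP.
  by apply: sub_jhull; apply: sub_down; exists s.
rewrite le_idealE; apply: jhull_min; first exact: ideal_is_ideal.
apply: down_min; first exact: ideal_is_ideal.
move=> _ [s Ds <-]; apply/principal_leP.
exact: (extend_ge S _ (marked_comp (reflection T) f) D s Ds).
Qed.

Lemma Id_mor_principal (S T : markedQuantale) (f : markedHom S T) (s : S) :
  Id_mor S T f (principal s) = principal (f s).
Proof. exact: extension_principal. Qed.

Lemma Id_mor1 (S : markedQuantale) :
  Id_mor S S (marked_id S) = quantale_id (ideal S).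
Proof. by apply/esym/extension_uniq/markedHom_eq. Qed.

Lemma Id_morM (S T U : markedQuantale) (g : markedHom T U)
    (f : markedHom S T) :
  Id_mor S U (marked_comp g f) = quantale_comp (Id_mor T U g) (Id_mor S T f).
Proof.
(* By uniqueness it suffices to compare both sides on principal ideals. *)
apply/esym/extension_uniq/markedHom_eq => s.
apply: etrans (Id_mor_principal T U g (f s)).
by have := congr1 (Id_mor T U g) (Id_mor_principal S T f s).
Qed.

Definition Id_functor : @functor_on markedQuantaleCat quantaleCat Id_obj :=
  @Functor markedQuantaleCat quantaleCat Id_obj Id_mor Id_mor1 Id_morM.

Definition Id_transpose (S : markedQuantale) (Q : quantaleType)
    (h : quantaleHom (ideal S) Q) : markedHom S (E_obj Q) :=
  marked_comp (E_mor h) (reflection S).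

Lemma Id_transpose_bij (S : markedQuantale) (Q : quantaleType) :
  bijective (Id_transpose S Q).
Proof.
exists (extension S Q) => [h|g]; last exact: extension_reflection.
exact/esym/extension_uniq.
Qed.

Definition Id_adjunction : adjunction Id_functor E.
Proof.
refine (@Adjunction markedQuantaleCat quantaleCat Id_obj E_obj Id_functor E
  Id_transpose Id_transpose_bij _ _) => [S S' Q f h|S Q Q' h g];
  apply: markedHom_eq => s //.
by have := congr1 h (Id_mor_principal S' S f s).
Defined.

Theorem proposition3p4 :
  exists (Id : @functor_on markedQuantaleCat quantaleCat Id_obj)
         (adj : adjunction Id E),
  [/\ (forall (S T : markedQuantale) (f : markedHom S T) (D : ideal S),
        (fmap Id f : quantaleHom (ideal S) (ideal T)) D =
          jideal (down [set f s | s in ideal_set D])),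
      (forall (S : markedQuantale) (s : S),
        (unit_of adj S : markedHom S (E_obj (Id_obj S))) s = principal s),
      (forall (S T : markedQuantale) (f : markedHom S T),
        (fmap Id f : quantaleHom (ideal S) (ideal T)) \o @principal S =
          @principal T \o f) &
      (forall S : markedQuantaleCat, is_reflection E (unit_of adj S))].
Proof.
exists Id_functor, Id_adjunction; split=> [S T f D|S s|S T f|S Q g].
- exact: Id_morE.
- by [].
- by apply/funext => s; exact: Id_mor_principal.
(* The unit is [reflection S] followed by an identity: the same function, but with other proof
   fields. *)
have unitE : unit_of Id_adjunction S = reflection S by exact: markedHom_eq.
rewrite unitE; exists (extension S Q g); split.
  exact: extension_reflection.
by move=> h /extension_uniq.
Qed.
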